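(* Let $f:\mathbb R^n\to\mathbb R$, $f(x)=x_1x_2\cdots x_n$. Then for any $r,s\in\mathbb R^n$ and each $i\in\{1,\dots,n\}$, the Aumann-Shapley-Shubik attribution $z_i(r,s,f)$ is computable (given $n$, $r$, $s$, $i$ as input) in $O(n^2)$ time and $O(n)$ memory.
   Context: The Aumann-Shapley-Shubik attribution of a multilinear function $f$ (a polynomial of degree at most $1$ in each variable) is the common value of the Aumann-Shapley attribution $(s_i-r_i)\int_0^1\partial_i f(r+t(s-r))\,dt$ and the Shapley-Shubik attribution $\frac1{n!}\sum_{\sigma\in S_n}\big[f(u^{\{j:\sigma(j)\le\sigma(i)\}})-f(u^{\{j:\sigma(j)<\sigma(i)\}})\big]$, where for $I\subseteq\{1,\dots,n\}$ the point $u^I\in\mathbb R^n$ has coordinates $u^I_j=s_j$ for $j\in I$ and $u^I_j=r_j$ for $j\notin I$; these two coincide for multilinear $f$. Time counts arithmetic operations ($+,-,\times,\div$) on real numbers, each at unit cost, and memory counts the number of stored real numbers. *)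

(* Defs.v *)
From HB Require Import structures.
From mathcomp Require Import all_boot all_order all_algebra all_fingroup finmap.
From mathcomp Require Import all_classical all_reals all_analysis.
Set Implicit Arguments.
Unset Strict Implicit.
Unset Printing Implicit Defensive.
Import Order.TTheory GRing.Theory Num.Theory.
Import numFieldNormedType.Exports.
Local Open Scope ring_scope.

Definition multilinear_fun (R : realType) (n : nat) (f : 'rV[R]_n -> R) : Prop :=
  exists c : {set 'I_n} -> R,
    forall x, f x = \sum_(I : {set 'I_n}) c I * \prod_(j in I) x ord0 j.

Definition partial_derivative (R : realType) (n : nat) (i : 'I_n)
    (f : 'rV[R]_n -> R) (x : 'rV[R]_n) : R :=
  'D_(delta_mx ord0 i) f x.

Definition aumann_shapley (R : realType) (n : nat) (r s : 'rV[R]_n)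
    (f : 'rV[R]_n -> R) (i : 'I_n) : R :=
  (s ord0 i - r ord0 i) *
  (\int[@lebesgue_measure R]_(t in `[0%R, 1%R])
     partial_derivative i f (r + t *: (s - r)))%R.

Definition mixed_point (R : realType) (n : nat) (r s : 'rV[R]_n)
    (I : {set 'I_n}) : 'rV[R]_n :=
  \row_j (if j \in I then s ord0 j else r ord0 j).

Definition shapley_shubik (R : realType) (n : nat) (r s : 'rV[R]_n)
    (f : 'rV[R]_n -> R) (i : 'I_n) : R :=
  (n`!)%:R^-1 *
  \sum_(sigma : 'S_n)
    (f (mixed_point r s [set j | (sigma j <= sigma i)%N]) -
     f (mixed_point r s [set j | (sigma j < sigma i)%N])).

(* [z] is the common value of the two attributions of the multilinear [f]. *)
Definition is_ass_attribution (R : realType) (n : nat) (r s : 'rV[R]_n)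
    (f : 'rV[R]_n -> R) (i : 'I_n) (z : R) : Prop :=
  [/\ multilinear_fun f, aumann_shapley r s f i = z & shapley_shubik r s f i = z].

(* A real random-access machine, presented as a while language.  Real numbers
   live in memory cells addressed by natural numbers.  A separate set of index
   variables, one for each name in [nat], holds natural numbers, used only for
   addressing and control: an index can never be turned into a real number nor
   conversely.  The only real constants are the numerals written in the program
   text, and programs do not depend on the input. *)

Inductive iexp : Type :=
| IConst of nat
| IVar of nat
| IAdd of iexp & iexp
| ISub of iexp & iexp (* truncated *)
| IMul of iexp & iexp.

Inductive arith_op : Type := OpAdd | OpSub | OpMul | OpDiv.

Inductive cmd : Type :=
| Skip
| Seq of cmd & cmd
| ISet of nat & iexp                        (* index variable := index *)
| RConst of iexp & nat                      (* cell := numeral *)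
| RCopy of iexp & iexp                      (* cell := cell *)
| RArith of arith_op & iexp & iexp & iexp   (* cell := cell op cell *)
| IfLt of iexp & iexp & cmd & cmd
| WhileLt of iexp & iexp & cmd.

Record state (R : realType) : Type := State {
  indices : nat -> nat;
  memory : {fmap nat -> R}
}.

Fixpoint ieval (env : nat -> nat) (e : iexp) : nat :=
  match e with
  | IConst k => k
  | IVar x => env x
  | IAdd e1 e2 => (ieval env e1 + ieval env e2)%N
  | ISub e1 e2 => (ieval env e1 - ieval env e2)%N
  | IMul e1 e2 => (ieval env e1 * ieval env e2)%N
  end.

Definition arith_eval (R : realType) (op : arith_op) (x y : R) : option R :=
  match op with
  | OpAdd => Some (x + y)
  | OpSub => Some (x - y)
  | OpMul => Some (x * y)
  | OpDiv => if y == 0 then None else Some (x / y)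
  end.

Definition set_index (R : realType) (st : state R) (x v : nat) : state R :=
  State (fun y => if y == x then v else indices st y) (memory st).

Definition set_cell (R : realType) (st : state R) (a : nat) (v : R) : state R :=
  State (indices st) (memory st).[a <- v]%fmap.

(* Reading a cell that holds no number, and dividing by 0, are errors: no rule
   applies. *)
Definition cell (R : realType) (st : state R) (e : iexp) : option R :=
  (memory st).[? ieval (indices st) e]%fmap.

Definition stored (R : realType) (st : state R) : nat :=
  #|` domf (memory st)|%fset.

(* [exec c st time space st']: started in [st], the command [c] halts in [st'],
   having performed [time] arithmetic operations on real numbers, and the
   largest number of reals stored simultaneously was [space]. *)
Inductive exec (R : realType) :
    cmd -> state R -> nat -> nat -> state R -> Prop :=
| ExecSkip st : exec Skip st 0 (stored st) st
| ExecSeq c1 c2 st1 st2 st3 t1 t2 m1 m2 :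
    exec c1 st1 t1 m1 st2 -> exec c2 st2 t2 m2 st3 ->
    exec (Seq c1 c2) st1 (t1 + t2)%N (maxn m1 m2) st3
| ExecISet st x e :
    exec (ISet x e) st 0 (stored st) (set_index st x (ieval (indices st) e))
| ExecRConst st a k :
    let st' := set_cell st (ieval (indices st) a) k%:R in
    exec (RConst a k) st 0 (maxn (stored st) (stored st')) st'
| ExecRCopy st a b v :
    cell st b = Some v ->
    let st' := set_cell st (ieval (indices st) a) v in
    exec (RCopy a b) st 0 (maxn (stored st) (stored st')) st'
| ExecRArith st op a b1 b2 v1 v2 v :
    cell st b1 = Some v1 -> cell st b2 = Some v2 ->
    arith_eval op v1 v2 = Some v ->
    let st' := set_cell st (ieval (indices st) a) v in
    exec (RArith op a b1 b2) st 1 (maxn (stored st) (stored st')) st'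
| ExecIfTrue st st' e1 e2 c1 c2 t m :
    (ieval (indices st) e1 < ieval (indices st) e2)%N ->
    exec c1 st t m st' -> exec (IfLt e1 e2 c1 c2) st t m st'
| ExecIfFalse st st' e1 e2 c1 c2 t m :
    (ieval (indices st) e2 <= ieval (indices st) e1)%N ->
    exec c2 st t m st' -> exec (IfLt e1 e2 c1 c2) st t m st'
| ExecWhileDone st e1 e2 c :
    (ieval (indices st) e2 <= ieval (indices st) e1)%N ->
    exec (WhileLt e1 e2 c) st 0 (stored st) st
| ExecWhileStep st1 st2 st3 e1 e2 c t1 t2 m1 m2 :
    (ieval (indices st1) e1 < ieval (indices st1) e2)%N ->
    exec c st1 t1 m1 st2 -> exec (WhileLt e1 e2 c) st2 t2 m2 st3 ->
    exec (WhileLt e1 e2 c) st1 (t1 + t2)%N (maxn m1 m2) st3.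

(* Input: index variables 0 and 1 hold [n] and the 0-based [i], all others 0;
   cells 0 .. n-1 hold [r], cells n .. 2n-1 hold [s], all others are empty. *)
Definition input_seq (R : realType) (n : nat) (r s : 'rV[R]_n) : seq R :=
  [seq r ord0 j | j <- enum 'I_n] ++ [seq s ord0 j | j <- enum 'I_n].

Definition input_state (R : realType) (n : nat) (r s : 'rV[R]_n) (i : 'I_n) :
    state R :=
  State (fun x => if x == 0%N then n else if x == 1%N then val i else 0%N)
    [fmap k : [fset k in iota 0 (n + n)]%fset => nth 0 (input_seq r s) (val k)]%fmap.

Definition output (R : realType) (st : state R) : option R :=
  (memory st).[? 0%N]%fmap.

(* Main.v *)
Require Import Defs.
From mathcomp Require Import all_boot all_order all_algebra all_classical all_reals.
From mathcomp Require Import all_fingroup finmap all_analysis zify.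
Set Implicit Arguments.
Unset Strict Implicit.
Unset Printing Implicit Defensive.
Import Order.TTheory GRing.Theory Num.Theory.
Import numFieldNormedType.Exports.
Local Open Scope ring_scope.

(* Let p be the product of the polynomials r_j + (s_j - r_j) X over j <> i and of
   the constant s_i - r_i.  The Aumann-Shapley attribution is the integral of p
   over [0, 1], that is, the sum of the p_k / (k + 1).  The Shapley-Shubik
   attribution has the same value: expand the product over the sets J of indices
   contributing a slope; the summand of J survives for the permutations placing
   all of J before i, and by symmetry these are a fraction 1 / (#|J| + 1) of all
   permutations.  Multiplying the n factors one by one into a single array of
   coefficients takes O(n^2) operations and O(n) cells. *)

(** * Counting permutations that place a given element last *)

Lemma card_perm_argmax (n : nat) (i : 'I_n) (J : {set 'I_n}) : i \notin J ->
  (#|J|.+1 * #|[set sg : 'S_n | [forall j in J, (sg j < sg i)%N]]|)%N = n`!.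
Proof.
(* [S k] collects the permutations that put [k] last among [K]. Exactly one [k] in [K] is last, so
   these classes partition the symmetric group. Composing with the transposition of [i] and [k] maps
   one class onto another, so all #|J| + 1 of them have equal size. *)
move=> iJ; pose K := i |: J.
pose S k := [set sg : 'S_n | [forall j in K, (sg j <= sg k)%N]].
have <- : S i = [set sg : 'S_n | [forall j in J, (sg j < sg i)%N]].
  apply/setP => sg; rewrite !inE; apply/forall_inP/forall_inP => h j.
    move=> jJ; rewrite ltn_neqAle h ?inE ?jJ ?orbT// andbT.
    apply: contraNneq iJ => /val_inj/perm_inj e; by rewrite -e.
  by rewrite !inE => /orP[/eqP->//|/h/ltnW].
have cardS k : k \in K -> #|S k| = #|S i|.
  move=> kK; rewrite -(card_preimset (S i) (mulgI (tperm i k))).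
  apply: eq_card => sg; rewrite !inE.
  have iK : i \in K by rewrite !inE eqxx.
  have tK j : j \in K -> tperm i k j \in K by case: tpermP => // ->.
  apply/forall_inP/forall_inP => h j jK; rewrite ?permM ?tpermL.
    exact/h/tK.
  by have := h _ (tK _ jK); rewrite !permM tpermK tpermL.
have -> : #|J|.+1 = #|K| by rewrite cardsU1 iJ.
rewrite -sum_nat_const -(eq_bigr _ cardS).
under eq_bigr do rewrite -sum1_card big_mkcond /=.
rewrite exchange_big/= -[RHS]card_Sn -sum1_card/= [RHS]big_mkcond.
apply: eq_bigr => sg _.
have iK : i \in K by rewrite !inE eqxx.
case: (arg_maxnP (fun j => val (sg j)) iK) => k kK kmax.
rewrite (bigD1 k kK)/= big1 ?addn0 => [|j /andP[jK jk]].
  by rewrite inE; case: forall_inP => // -[] j; exact: kmax.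
rewrite inE; case: forall_inP => // h; case/eqP: jk.
apply: (@perm_inj _ sg); apply: val_inj; apply/eqP.
by rewrite eqn_leq h// andbT; exact: kmax.
Qed.

(** * Derivatives of the product, and integrals of polynomials over [0, 1] *)

Lemma partial_derivative_prod (R : realType) (n : nat) (i : 'I_n) (x : 'rV[R]_n) :
  partial_derivative i (fun y : 'rV[R]_n => \prod_(j < n) y ord0 j) x =
  \prod_(j < n | j != i) x ord0 j.
Proof.
rewrite /partial_derivative /derive.
apply: cvg_lim => //.
(* The product is affine in coordinate i, so the difference quotient is constant for h different
   from 0. *)
apply: cvg_near_cst.
near=> h.
have h0 : h != 0 by near: h; exact: nbhs_dnbhs_neq.
rewrite /= (bigD1 i)//= [X in _ - X](bigD1 i)//= !mxE !eqxx/=.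
have -> : \prod_(j < n | j != i) (h *: delta_mx ord0 i + x) ord0 j =
    \prod_(j < n | j != i) x ord0 j.
  by apply: eq_bigr => j /negPf ji; rewrite !mxE ji andbF mulr0 add0r.
by rewrite mulr1 -mulrBl addrK /GRing.scale/= mulKf.
Unshelve. all: by end_near.
Qed.

Definition integral01 (R : realType) (p : {poly R}) : R :=
  \sum_(k < size p) p`_k / k.+1%:R.

Lemma integral01_widen (R : realType) (p : {poly R}) (m : nat) :
  (size p <= m)%N -> integral01 p = \sum_(k < m) p`_k / k.+1%:R.
Proof.
move=> pm; rewrite /integral01 (big_ord_widen m (fun k => p`_k / k.+1%:R) pm) big_mkcond.
apply: eq_bigr => k _; case: ltnP => // /(nth_default 0) ->; by rewrite mul0r.
Qed.

Lemma Rintegral_horner01 (R : realType) (p : {poly R}) :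
  \int[@lebesgue_measure R]_(t in `[0%R, 1%R]) p.[t] = integral01 p.
Proof.
(* The antiderivative of [p] vanishing at 0: at k = 0 the formula divides by 0, and the inverse of 0
   is 0 by convention. *)
pose q : {poly R} := \poly_(k < (size p).+1) (p`_k.-1 / k%:R).
have q'p : q^`() = p.
  apply/polyP => k; rewrite coef_deriv coef_poly ltnS.
  case: ltnP => [_|/(nth_default 0)->]; last by rewrite mul0rn.
  by rewrite -[LHS]mulr_natr divfK// pnatr_eq0.
rewrite /Rintegral (@continuous_FTC2 _ _ (horner q)) //=.
- rewrite horner_coef0 horner_coef (big_ord_widen (size p).+1 (fun k => q`_k * 1 ^+ k)) ?size_poly//.
  rewrite big_mkcond big_ord_recl /= coef_poly invr0 mulr0 subr0.
  rewrite expr0 mulr1 if_same add0r.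
  apply: eq_bigr => k _; rewrite expr1n mulr1 /bump add1n.
  case: ltnP => [_|/(nth_default 0) e].
    by rewrite coef_poly ltnS ltn_ord.
  by rewrite -[LHS]e coef_poly ltnS ltn_ord.
- by apply: continuous_subspaceT => x; exact: continuous_horner.
- split => [x _||]; first exact: derivable_horner.
  + by apply: cvg_at_right_filter; exact: continuous_horner.
  + by apply: cvg_at_left_filter; exact: continuous_horner.
- by move=> x _; rewrite -derivE q'p.
Qed.

(** * The common value of the two attributions *)

Section Attribution.
Variables (R : realType) (n : nat) (r s : 'rV[R]_n) (i : 'I_n).

(** Coordinate i gets the same value at both ends, so its factor in [path_poly] is the constant s_i
    - r_i and the product runs uniformly over all j. *)
Definition lower (j : 'I_n) : R :=
  if j == i then s ord0 i - r ord0 i else r ord0 j.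
Definition upper (j : 'I_n) : R :=
  if j == i then s ord0 i - r ord0 i else s ord0 j.
Definition path_poly : {poly R} :=
  \prod_(j < n) ((lower j)%:P + (upper j - lower j) *: 'X).

Lemma aumann_shapley_prod :
  aumann_shapley r s (fun x : 'rV[R]_n => \prod_(j < n) x ord0 j) i =
  integral01 path_poly.
Proof.
set d := s ord0 i - r ord0 i.
pose p : {poly R} :=
  \prod_(j < n | j != i) ((r ord0 j)%:P + (s ord0 j - r ord0 j) *: 'X).
have -> : path_poly = d *: p.
  rewrite /path_poly (bigD1 i)//= /lower /upper eqxx subrr scale0r addr0 mul_polyC.
  congr (_ *: _); apply: eq_bigr => j /negPf ji; by rewrite ji.
rewrite (@integral01_widen _ _ (size p)) ?size_scale_leq// /aumann_shapley.
under eq_Rintegral => t _.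
  rewrite partial_derivative_prod.
  have -> : \prod_(j < n | j != i) (r + t *: (s - r)) ord0 j = p.[t].
    rewrite horner_prod; apply: eq_bigr => j _.
    by rewrite !mxE hornerD hornerC hornerZ hornerX [in RHS]mulrC.
  over.
rewrite Rintegral_horner01 big_distrr/=.
by apply: eq_bigr => k _; rewrite coefZ mulrA.
Qed.

Lemma shapley_shubik_prod :
  shapley_shubik r s (fun x : 'rV[R]_n => \prod_(j < n) x ord0 j) i =
  integral01 path_poly.
Proof.
pose v j := upper j - lower j.
pose c (J : {set 'I_n}) : R := \prod_j (if j \in J then v j else lower j).
(* Index i has slope 0, so sets containing it contribute nothing; this leaves exactly the sets to
   which [card_perm_argmax] applies. *)
have vi : v i = 0 by rewrite /v /upper /lower eqxx subrr.
have c0 (J : {set 'I_n}) : i \in J -> c J = 0.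
  by move=> iJ; rewrite /c (bigD1 i)//= iJ vi mul0r.
have pE : path_poly = \sum_(J : {set 'I_n}) c J *: 'X^#|J|.
  rewrite /path_poly.
  under eq_bigr do rewrite addrC.
  rewrite bigA_distr; apply: eq_bigr => J _.
  rewrite -mul_polyC /c rmorph_prod/= -[#|J|]sum1_card -prodrXr /=.
  rewrite big_mkcond [X in _ * X]big_mkcond -big_split/=; apply: eq_bigr => j _.
  by case: ifP => _; rewrite ?mulr1// mul_polyC expr1.
have sz : (size path_poly <= n.+1)%N.
  rewrite pE; apply: (leq_trans (size_sum _ _ _)); apply/bigmax_leqP => J _.
  rewrite (leq_trans (size_scale_leq _ _))// size_polyXn ltnS.
  by rewrite -[leqRHS]card_ord max_card.
rewrite (integral01_widen sz).
(* Both attributions are compared with this sum. For the integral, the monomial of degree #|J|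
   contributes 1 / (#|J| + 1). *)
transitivity (\sum_(J : {set 'I_n}) c J / #|J|.+1%:R); last first.
  rewrite pE.
  under [RHS]eq_bigr do rewrite coef_sum mulr_suml.
  rewrite exchange_big/=; apply: eq_bigr => J _.
  have Jn : (#|J| < n.+1)%N by rewrite ltnS -[leqRHS]card_ord max_card.
  rewrite (bigD1 (Ordinal Jn))//= coefZ coefXn eqxx mulr1 big1 ?addr0// => k kJ.
  rewrite coefZ coefXn; case: eqP => [e|]; last by rewrite mulr0 mul0r.
  by case/eqP: kJ; apply: val_inj.
rewrite /shapley_shubik.
have termE (sg : 'S_n) :
    \prod_(j < n) mixed_point r s [set j | (sg j <= sg i)%N] ord0 j -
    \prod_(j < n) mixed_point r s [set j | (sg j < sg i)%N] ord0 j =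
    \sum_(J : {set 'I_n}) c J * ([forall j in J, (sg j < sg i)%N])%:R.
  (* For j other than i, sg j <= sg i amounts to sg j < sg i. The two products thus differ only in
     factor i, and their difference replaces that factor by s_i - r_i, which is [lower i]. *)
  transitivity (\prod_j ((if (sg j < sg i)%N then v j else 0) + lower j)).
    rewrite (bigD1 i)//= [X in _ - X](bigD1 i)//= [RHS](bigD1 i)//=.
    rewrite !mxE !inE leqnn ltnn add0r {1}/lower eqxx mulrBl.
    congr (_ * _ - _ * _); apply: eq_bigr => j ji; rewrite !mxE !inE.
      rewrite leq_eqVlt val_eqE (inj_eq perm_inj) (negPf ji)/= /v /upper /lower (negPf ji).
      by case: ifP => _; rewrite ?subrK ?add0r.
    rewrite /v /upper /lower (negPf ji).
    by case: ifP => _; rewrite ?subrK ?add0r.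
  rewrite bigA_distr; apply: eq_bigr => J _.
  case: forall_inP => [h|/forall_inP]; rewrite ?mulr1 ?mulr0.
    by apply: eq_bigr => j _; case: ifP => // jJ; rewrite h.
  rewrite negb_forall_in => /exists_inP[j jJ /negPf h].
  by rewrite (bigD1 j)//= jJ h mul0r.
rewrite (eq_bigr _ (fun sg _ => termE sg)) exchange_big/= mulr_sumr.
apply: eq_bigr => J _.
have [iJ|iJ] := boolP (i \in J).
  by rewrite c0// mul0r big1 ?mulr0// => sg _; rewrite mul0r.
rewrite -mulr_sumr mulrCA; congr (_ * _).
pose S := [set sg : 'S_n | [forall j in J, (sg j < sg i)%N]].
have -> : \sum_(sg : 'S_n) ([forall j in J, (sg j < sg i)%N])%:R = #|S|%:R :> R.
  rewrite -natr_sum -sum1_card [in RHS]big_mkcond; congr (_%:R).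
  by apply: eq_bigr => sg _; rewrite inE; case: [forall _ in _, _].
rewrite -(card_perm_argmax iJ) natrM -/S.
(* [#|S|] divides n!, hence is nonzero and can be cancelled. *)
have S0 : (#|S|%:R : R) != 0.
  have := fact_gt0 n; rewrite -(card_perm_argmax iJ) muln_gt0 -/S => /andP[_].
  by rewrite pnatr_eq0 lt0n.
by rewrite invfM mulfVK.
Qed.

(** Factor i is constant, so the degree is at most n - 1. This is why n coefficient cells, besides
    the one for the extra ['X], suffice. *)
Lemma size_path_poly : (size path_poly <= n)%N.
Proof.
rewrite /path_poly (bigD1 i)//= /lower /upper eqxx subrr scale0r addr0 mul_polyC.
rewrite (leq_trans (size_scale_leq _ _))//.
rewrite (leq_trans (size_prod_leq _ _))//=.
have szf j : (size ((lower j)%:P + (upper j - lower j) *: 'X : {poly R})%R <= 2)%N.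
  rewrite (leq_trans (size_polyD _ _))// geq_max.
  by rewrite (leq_trans (size_polyC_leq1 _))// (leq_trans (size_scale_leq _ _))// size_polyX.
(* There are n - 1 factors of size at most 2, whence 2(n - 1) + 1 - (n - 1) = n. *)
apply: (@leq_trans ((\sum_(j < n | j != i) 2).+1 - #|[pred j | j != i]|)).
  by rewrite leq_sub2r// ltnS; apply: leq_sum => j _; exact: szf.
rewrite sum_nat_const cardC1 card_ord; have := ltn_ord i; lia.
Qed.
End Attribution.

Lemma multilinear_prod (R : realType) (n : nat) :
  multilinear_fun (fun x : 'rV[R]_n => \prod_(j < n) x ord0 j).
Proof.
exists (fun I : {set 'I_n} => (I == [set: 'I_n])%:R) => x.
rewrite (bigD1 [set: 'I_n])//= eqxx mul1r [X in _ + X]big1 ?addr0.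
  by apply: eq_bigl => j; rewrite inE.
by move=> I /negPf->; rewrite mul0r.
Qed.

(** * A program logic with time and space bounds *)

Section Hoare.
Variables (R : realType) (B : nat).
Implicit Types (st : state R) (Q : state R -> Prop).

(** Confining the addresses below B bounds the number of stored reals by B, so space bounds reduce
    to address arithmetic. *)
Definition bounded st := forall k, (memory st).[? k]%fmap -> (k < B)%N.

Definition runs (c : cmd) st (T : nat) Q := exists t m st',
  [/\ exec c st t m st', (t <= T)%N, (m <= B)%N, bounded st' & Q st'].

Lemma stored_bounded st : bounded st -> (stored st <= B)%N.
Proof.
move=> bst; rewrite /stored.
have /fsubset_leq_card : (domf (memory st) `<=` seq_fset tt (iota 0 B))%fset.
  apply/fsubsetP => k kst; rewrite seq_fsetE mem_iota /=.
  by apply: bst; rewrite in_fnd.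
by move/leq_trans; apply; rewrite size_seq_fset undup_id ?iota_uniq// size_iota.
Qed.

Lemma bounded_set_cell st a v : bounded st -> (a < B)%N -> bounded (set_cell st a v).
Proof. by move=> bst aB k; rewrite fnd_set; case: eqP => [->//|_ /bst]. Qed.

Lemma stored_set_cell st a v : bounded st -> (a < B)%N ->
  (maxn (stored st) (stored (set_cell st a v)) <= B)%N.
Proof.
by move=> bst aB; rewrite geq_max !stored_bounded//; exact: bounded_set_cell.
Qed.

Lemma runs_weaken c st T T' Q Q' : runs c st T Q -> (T <= T')%N ->
  (forall st', bounded st' -> Q st' -> Q' st') -> runs c st T' Q'.
Proof.
move=> [t [m [st' [e tT mB b q]]]] TT' QQ'; exists t, m, st'.
by split=> //; [exact: leq_trans TT'|exact: QQ'].
Qed.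

(** The postcondition of [c1] is itself the claim about [c2], so a proof can follow the program text
    one command at a time. *)
Lemma runs_seq T1 T2 c1 c2 st Q :
  runs c1 st T1 (fun st' => bounded st' -> runs c2 st' T2 Q) ->
  runs (Seq c1 c2) st (T1 + T2) Q.
Proof.
move=> [t1 [m1 [st1 [e1 tT1 mB1 b1 /(_ b1)]]]].
move=> [t2 [m2 [st2 [e2 tT2 mB2 b2 q2]]]].
exists (t1 + t2)%N, (maxn m1 m2), st2.
by split=> //; [exact: ExecSeq e1 e2|exact: leq_add|rewrite geq_max mB1].
Qed.

Lemma runs_iset x e st Q : bounded st ->
  Q (set_index st x (ieval (indices st) e)) -> runs (ISet x e) st 0 Q.
Proof.
move=> b q; exists 0%N, (stored st), (set_index st x (ieval (indices st) e)).
by split=> //; [exact: ExecISet|exact: stored_bounded].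
Qed.

Lemma runs_rconst a k st Q : bounded st -> (ieval (indices st) a < B)%N ->
  Q (set_cell st (ieval (indices st) a) k%:R) -> runs (RConst a k) st 0 Q.
Proof.
move=> b aB q; eexists _, _, _; split; [exact: ExecRConst|by []| | |exact: q].
  exact: stored_set_cell.
exact: bounded_set_cell.
Qed.

Lemma runs_rcopy v a a' st Q : bounded st -> (ieval (indices st) a < B)%N ->
  cell st a' = Some v ->
  Q (set_cell st (ieval (indices st) a) v) -> runs (RCopy a a') st 0 Q.
Proof.
move=> b aB ev q; eexists _, _, _.
split; [exact: ExecRCopy ev|by []| | |exact: q].
  exact: stored_set_cell.
exact: bounded_set_cell.
Qed.

Lemma runs_rarith v1 v2 v op a a1 a2 st Q : bounded st ->
  (ieval (indices st) a < B)%N ->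
  cell st a1 = Some v1 -> cell st a2 = Some v2 -> arith_eval op v1 v2 = Some v ->
  Q (set_cell st (ieval (indices st) a) v) -> runs (RArith op a a1 a2) st 1 Q.
Proof.
move=> b aB ev1 ev2 ev q; eexists _, _, _.
split; [exact: ExecRArith ev1 ev2 ev|by []| | |exact: q].
  exact: stored_set_cell.
exact: bounded_set_cell.
Qed.

(** The invariant is indexed by the number of completed passes, so it also yields termination: the
    guard holds before each of N passes and fails after them. *)
Lemma runs_while (N T : nat) (I : nat -> state R -> Prop) e1 e2 c st :
  (forall k st', bounded st' -> (k < N)%N -> I k st' ->
     (ieval (indices st') e1 < ieval (indices st') e2)%N /\
     runs c st' T (I k.+1)) ->
  (forall st', I N st' ->
     (ieval (indices st') e2 <= ieval (indices st') e1)%N) ->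
  bounded st -> I 0%N st -> runs (WhileLt e1 e2 c) st (N * T) (I N).
Proof.
move=> step stop b I0.
suff H j k st' : (k + j = N)%N -> bounded st' -> I k st' ->
    runs (WhileLt e1 e2 c) st' (j * T) (I N) by exact: (H N 0%N).
elim: j k st' => [|j IH] k st' kN b' Ik.
  rewrite addn0 in kN; rewrite kN in Ik; exists 0%N, (stored st'), st'.
  by split=> //; [exact/ExecWhileDone/stop|exact: stored_bounded].
have kltN : (k < N)%N by rewrite -kN -addn1 leq_add2l.
have [lt [t1 [m1 [st1 [ex1 tT1 mB1 b1 I1]]]]] := step k st' b' kltN Ik.
rewrite addnS -addSn in kN.
have [t2 [m2 [st2 [ex2 tT2 mB2 b2 I2]]]] := IH _ _ kN b1 I1.
exists (t1 + t2)%N, (maxn m1 m2), st2; split=> //.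
- exact: ExecWhileStep ex1 ex2.
- by rewrite mulSn leq_add.
- by rewrite geq_max mB1.
Qed.
End Hoare.

(** * The program *)

Section Program.

(* Memory: cells 0 .. n-1 hold the constant terms of the factors, cells
   n .. 2n-1 their values at 1, turned into slopes one at a time.  Cell 2n + k
   holds the coefficient of 'X^k in 'X * (product of the factors processed so
   far); the extra 'X makes cell 2n a permanent 0, so the update of the lowest
   coefficient is not a special case.  Cells 3n+1 and 3n+2 are scratch; once the
   expansion is over, cells 0 and 1 are recycled.  Index variable 2
   is the factor or coefficient being processed, and 3 counts updates. *)
Local Notation "'#' k" := (IConst k) (at level 1, format "'#' k").
Local Notation ix := IVar.
Local Notation "a +' b" := (IAdd a b) (at level 50, left associativity).
Local Notation "a *' b" := (IMul a b) (at level 40, left associativity).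
Local Notation "c1 ;; c2" := (Seq c1 c2) (at level 90, right associativity).

Definition incr (x : nat) : cmd := ISet x (ix x +' #1).

(** Cells n + i and i both receive s_i - r_i, which realizes [upper] and [lower] in memory. The
    subtraction comes first, while r_i is still available. *)
Definition setup : cmd :=
  RArith OpSub (ix 1) (ix 0 +' ix 1) (ix 1) ;;
  RCopy (ix 0 +' ix 1) (ix 1).

Definition init : cmd :=
  RConst (#2 *' ix 0) 0 ;;
  ISet 2 #0 ;;
  WhileLt (ix 2) (ix 0)
    (RConst (#2 *' ix 0 +' ix 2 +' #1) 0 ;; incr 2) ;;
  RConst (#2 *' ix 0 +' #1) 1 ;;
  ISet 2 #0.

(** Let j and q be the values of indices 2 and 3, and k = n - q: address 3n - q is cell 2n + k. The
    step performs c_k := a_j c_k + d_j c_{k-1}, where a_j is the constant term and d_j the slope of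
    factor j. Since k runs from n down to 1, cell 2n is never overwritten. *)
Definition expand_step : cmd :=
  RArith OpMul (#3 *' ix 0 +' #1) (ix 0 +' ix 2) (ISub (#3 *' ix 0) (ix 3 +' #1)) ;;
  RArith OpMul (ISub (#3 *' ix 0) (ix 3)) (ix 2) (ISub (#3 *' ix 0) (ix 3)) ;;
  RArith OpAdd (ISub (#3 *' ix 0) (ix 3))
    (ISub (#3 *' ix 0) (ix 3)) (#3 *' ix 0 +' #1) ;;
  incr 3.

Definition expand : cmd :=
  WhileLt (ix 2) (ix 0)
    (RArith OpSub (ix 0 +' ix 2) (ix 0 +' ix 2) (ix 2) ;;
     ISet 3 #0 ;;
     WhileLt (ix 3) (ix 0) expand_step ;;
     incr 2).

(** An index cannot become a real, so the divisors 1, 2, ... are produced in cell 3n + 2 by adding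
    the 1 kept in cell 3n + 1. Cell 0 accumulates the sum and cell 1 holds the current quotient. *)
Definition integrate : cmd :=
  RConst #0 0 ;;
  RConst (#3 *' ix 0 +' #1) 1 ;;
  RConst (#3 *' ix 0 +' #2) 0 ;;
  ISet 2 #0 ;;
  WhileLt (ix 2) (ix 0)
    (RArith OpAdd (#3 *' ix 0 +' #2) (#3 *' ix 0 +' #2) (#3 *' ix 0 +' #1) ;;
     RArith OpDiv #1 (#2 *' ix 0 +' ix 2 +' #1) (#3 *' ix 0 +' #2) ;;
     RArith OpAdd #0 #0 #1 ;;
     incr 2).

Definition compute : cmd := init ;; expand ;; integrate.

Definition ass_program : cmd := setup ;; compute.

End Program.

(** * Correctness and cost of the three phases *)

Section Correctness.
Variables (R : realType) (n : nat) (A U : nat -> R).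
Hypothesis n_gt0 : (0 < n)%N.
Implicit Types (st : state R) (F : nat -> R).

Local Notation B := (3 * n + 3)%N.
Local Notation get st a := ((memory st).[? a]%fmap).

Definition holds (N : nat) F st := forall a, (a < N)%N -> get st a = Some (F a).

(** One rule for overwriting a cell of the known prefix and for extending that prefix by one
    cell. *)
Lemma holds_set_cell N N' F F' st b v : holds N F st ->
  ((b < N')%N -> F' b = v) ->
  (forall a, (a < N')%N -> a <> b -> (a < N)%N /\ F a = F' a) ->
  holds N' F' (set_cell st b v).
Proof.
move=> h vE FE a aN; rewrite fnd_set; case: eqP => [ab|ab].
  by rewrite -ab in vE; rewrite vE.
by have [aN' <-] := FE a aN ab; rewrite h.
Qed.

Definition layout (f g h : nat -> R) (a : nat) : R :=
  if (a < n)%N then f a else if (a < 2 * n)%N then g (a - n)%N else h (a - 2 * n)%N.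

Lemma layout1 f g h a : (a < n)%N -> layout f g h a = f a.
Proof. by rewrite /layout => ->. Qed.

Lemma layout2 f g h a : (a < n)%N -> layout f g h (n + a)%N = g a.
Proof.
move=> an; rewrite /layout ifF; last lia.
by rewrite ifT ?addKn//; lia.
Qed.

Lemma layout3 f g h a : layout f g h (2 * n + a)%N = h a.
Proof.
rewrite /layout ifF; last lia.
by rewrite ifF ?addKn//; lia.
Qed.

Lemma eq_layout f g h f' g' h' a :
  ((a < n)%N -> f a = f' a) ->
  ((n <= a < 2 * n)%N -> g (a - n)%N = g' (a - n)%N) ->
  ((2 * n <= a)%N -> h (a - 2 * n)%N = h' (a - 2 * n)%N) ->
  layout f g h a = layout f' g' h' a.
Proof.
rewrite /layout => e1 e2 e3; case: ltnP => [/e1//|an]; case: ltnP => [an2|/e3//].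
by apply: e2; rewrite an.
Qed.

Definition factors (j : nat) : {poly R} :=
  \prod_(l < j) ((A l)%:P + (U l - A l) *: 'X).

Lemma factorsS j k :
  ('X * factors j.+1)`_k.+1 =
  A j * ('X * factors j)`_k.+1 + (U j - A j) * ('X * factors j)`_k.
Proof.
rewrite {1}/factors big_ord_recr/= -/(factors j) mulrA mulrDr coefD -scalerAr.
by rewrite [_ * _%:P]mulrC coefCM coefZ coefMX.
Qed.

Lemma runs_init st : bounded B st -> indices st 0%N = n ->
  holds (2 * n) (layout A U (fun => 0)) st ->
  runs B init st 0 (fun st' =>
    [/\ indices st' 0%N = n, indices st' 2%N = 0%N &
        holds (3 * n + 1) (layout A U (fun k => ('X * factors 0)`_k)) st']).
Proof.
move=> b e0 h.
apply: (@runs_seq _ _ 0 0); apply: runs_rconst => //=; rewrite e0; first lia.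
move=> b1; apply: (@runs_seq _ _ 0 0); apply: runs_iset => //= b2.
(* The prefix has j + 1 cleared coefficients because cell 2n is cleared before the loop. *)
pose I j st' := [/\ indices st' 0%N = n, indices st' 2%N = j &
  holds (2 * n + j.+1) (layout A U (fun => 0)) st'].
apply: (@runs_seq _ _ 0 0).
apply: (@runs_weaken _ _ _ _ (n * 0) _ (I n)); [|by rewrite muln0|].
  apply: (@runs_while _ _ n 0 I) => //; first last.
  - split=> //=; apply: (holds_set_cell h) => [_|a a1 a2]; last by split=> //; lia.
    by rewrite -[(2 * n)%N]addn0 layout3.
  - by move=> st' [/= -> ->].
  move=> j st' b' jn [e0' e2' h'] /=; rewrite e0' e2'; split=> //.
  apply: (@runs_seq _ _ 0 0); apply: runs_rconst => //=; rewrite e0' e2'; first lia.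
  move=> b1'; apply: runs_iset => //; split=> //=; first by rewrite e2' addn1.
  apply: (holds_set_cell h') => [_|a a1 a2]; last by split=> //; lia.
  by rewrite -addnA layout3.
move=> {b e0 h b1 b2}st b [e0 e2 h] _.
apply: (@runs_seq _ _ 0 0); apply: runs_rconst => //=; rewrite e0; first lia.
move=> b1; apply: runs_iset => //=; split=> //=.
have fE k : ('X * factors 0)`_k = (k == 1)%:R.
  by rewrite /factors big_ord0 mulr1 coefX.
apply: (holds_set_cell h) => [_|a a1 a2]; first by rewrite layout3 fE.
split; first lia.
apply: eq_layout => // an; rewrite fE; case: eqP => //; lia.
Qed.

Definition slopes j k := if (k < j)%N then U k - A k else U k.

(* The coefficients are updated in place from the highest down, so that the
   update of each one still sees the old value of the one below. *)
Lemma runs_expand_step st j q : bounded B st -> (j < n)%N -> (q < n)%N ->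
  let F q := layout A (slopes j.+1)
    (fun k => if (k <= n - q)%N then ('X * factors j)`_k
              else ('X * factors j.+1)`_k) in
  [/\ indices st 0%N = n, indices st 2%N = j, indices st 3%N = q &
      holds (3 * n + 1) (F q) st] ->
  runs B expand_step st 3 (fun st' =>
    [/\ indices st' 0%N = n, indices st' 2%N = j, indices st' 3%N = q.+1 &
      holds (3 * n + 1) (F q.+1) st']).
Proof.
move=> b jn qn F [e0 e2 e3 h].
have eC k : (k <= n)%N -> (3 * n - k = 2 * n + (n - k))%N by lia.
apply: (@runs_seq _ _ 1 2).
apply: (@runs_rarith _ _ (U j - A j) (('X * factors j)`_(n - q.+1))) => //=.
- by rewrite e0; lia.
- rewrite /cell/= e0 e2 h; last lia.
  by rewrite /F layout2// /slopes ltnS leqnn.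
- rewrite /cell/= e0 e3 addn1 h; last lia.
  by rewrite eC// /F layout3 ifT//; lia.
move=> b1.
apply: (@runs_seq _ _ 1 1).
apply: (@runs_rarith _ _ (A j) (('X * factors j)`_(n - q))) => //=.
- by rewrite e0; lia.
- rewrite /cell/= e0 e2 fnd_set ifF; last lia.
  by rewrite h ?/F ?layout1//; lia.
- rewrite /cell/= e0 e3 fnd_set ifF; last lia.
  rewrite h; last lia.
  by rewrite eC ?/F ?layout3 ?leqnn//; lia.
move=> b2.
apply: (@runs_seq _ _ 1 0).
apply: (@runs_rarith _ _ (A j * ('X * factors j)`_(n - q))
   ((U j - A j) * ('X * factors j)`_(n - q.+1))) => //=.
- by rewrite e0; lia.
- by rewrite /cell/= !fnd_set eqxx.
- rewrite /cell/= !fnd_set ifF; last by rewrite e0; lia.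
  by rewrite eqxx.
move=> b3; apply: runs_iset => //; split=> //=; first by rewrite e3 addn1.
(* Since q < n, the index n - q is a successor, as [factorsS] requires. *)
have -> : A j * ('X * factors j)`_(n - q) +
    (U j - A j) * ('X * factors j)`_(n - q.+1) = ('X * factors j.+1)`_(n - q).
  by rewrite subnS; have : (0 < n - q)%N; [lia|case: (n - q)%N => // k _; rewrite factorsS].
rewrite e0 e3 => a aN; rewrite !fnd_set /=; case: eqP => [->|ab].
  by rewrite eC ?/F ?layout3 ?ifF//; lia.
rewrite ifF; last lia.
rewrite h//; congr Some; apply: eq_layout => // an.
case: leqP => ?; first by rewrite ifT//; lia.
by rewrite ifF//; lia.
Qed.

Lemma runs_expand st : bounded B st ->
  [/\ indices st 0%N = n, indices st 2%N = 0%N &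
        holds (3 * n + 1) (layout A U (fun k => ('X * factors 0)`_k)) st] ->
  runs B expand st (n * (1 + n * 3)) (fun st' => indices st' 0%N = n /\
    forall k, (k <= n)%N -> get st' (2 * n + k)%N = Some ('X * factors n)`_k).
Proof.
move=> b [e0 e2 h].
pose I j st' := [/\ indices st' 0%N = n, indices st' 2%N = j &
  holds (3 * n + 1) (layout A (slopes j) (fun k => ('X * factors j)`_k)) st'].
apply: (@runs_weaken _ _ _ _ (n * (1 + n * 3)) _ (I n)) => //; last first.
  move=> st' _ [? _ h']; split=> // k kn; rewrite h' ?layout3//; lia.
apply: (@runs_while _ _ n (1 + n * 3) I) => //; last first.
- by move=> st' [/= -> ->].
move=> j {b e0 e2 h}st b jn [e0 e2 h] /=; rewrite e0 e2; split=> //.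
apply: (@runs_seq _ _ 1 (n * 3)).
apply: (@runs_rarith _ _ (U j) (A j)) => //=.
- by rewrite e0 e2; lia.
- by rewrite /cell/= e0 e2 h ?layout2 ?/slopes ?ltnn//; lia.
- by rewrite /cell/= e2 h ?layout1//; lia.
move=> b1.
apply: (@runs_seq _ _ 0 (n * 3)); apply: runs_iset => // b2.
rewrite -[(n * 3)%N]addn0.
pose J q st' := [/\ indices st' 0%N = n, indices st' 2%N = j, indices st' 3%N = q &
      holds (3 * n + 1) (layout A (slopes j.+1)
    (fun k => if (k <= n - q)%N then ('X * factors j)`_k
              else ('X * factors j.+1)`_k)) st'].
apply: (@runs_seq _ _ (n * 3) 0).
apply: (@runs_weaken _ _ _ _ (n * 3) _ (J n)) => //.
  apply: (@runs_while _ _ n 3 J) => //; first last.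
  - split=> //=; rewrite e0 e2; apply: (holds_set_cell h) => [_|a aN ab].
      by rewrite layout2// /slopes ltnS leqnn.
    split=> //; apply: eq_layout => // an; last by rewrite ifT//; lia.
    (* [slopes j] and [slopes j.+1] differ only at j, whose cell has just been written. *)
    rewrite /slopes ltnS [in RHS]leq_eqVlt orbC; case: ifP => //= _.
    by rewrite ifF//; lia.
  - by move=> st' [/= -> _ ->].
  move=> q st' b' qn [e0' e2' e3' h'] /=; rewrite e0' e3'; split=> //.
  by apply: runs_expand_step.
move=> {b e0 e2 h b1 b2}st b [e0 e2 e3 h] _.
apply: runs_iset => //; split=> //=; first by rewrite e2 addn1.
move=> a aN; rewrite h//; congr Some; apply: eq_layout => // an.
(* Only the coefficient of index 0 was not updated; the extra ['X] makes it 0 in both the old and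
   the new product. *)
rewrite subnn leqn0; case: eqP => // ->; by rewrite !coefXM.
Qed.

Lemma runs_integrate st : bounded B st -> indices st 0%N = n ->
  (forall k, (k <= n)%N -> get st (2 * n + k)%N = Some ('X * factors n)`_k) ->
  runs B integrate st (n * 3) (fun st' =>
    output st' = Some (\sum_(k < n) (factors n)`_k / k.+1%:R)).
Proof.
move=> b e0 h.
apply: (@runs_seq _ _ 0 (n * 3)); apply: runs_rconst => //=; first lia.
move=> b1.
apply: (@runs_seq _ _ 0 (n * 3)); apply: runs_rconst => //=; rewrite e0; first lia.
move=> b2.
apply: (@runs_seq _ _ 0 (n * 3)); apply: runs_rconst => //=; rewrite e0; first lia.
move=> b3.
apply: (@runs_seq _ _ 0 (n * 3)); apply: runs_iset => //= b4.
pose I j st' := [/\ indices st' 0%N = n /\ indices st' 2%N = j,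
  forall k, (k <= n)%N -> get st' (2 * n + k)%N = Some ('X * factors n)`_k,
  get st' 0%N = Some (\sum_(k < j) (factors n)`_k / k.+1%:R),
  get st' (3 * n + 1)%N = Some 1 &
  get st' (3 * n + 2)%N = Some j%:R].
apply: (@runs_weaken _ _ _ _ (n * 3) _ (I n)) => //; last by move=> ? _ [].
apply: (@runs_while _ _ n 3 I) => //; first last.
- split=> //= [k kn|||]; rewrite !fnd_set.
  + rewrite !ifF ?h//; lia.
  + by rewrite !ifF ?eqxx ?big_ord0//; lia.
  + by rewrite ifF ?eqxx//; lia.
  + by rewrite eqxx.
- by move=> st' [/= [-> ->]].
move=> j {b e0 h b1 b2 b3 b4}st b jn [[e0 e2] h h0 h1 h2] /=.
rewrite e0 e2; split=> //.
apply: (@runs_seq _ _ 1 2).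
apply: (@runs_rarith _ _ j%:R 1 j.+1%:R) => //=.
- by rewrite e0; lia.
- by rewrite /cell/= e0.
- by rewrite /cell/= e0.
- by rewrite -natr1.
move=> b1.
apply: (@runs_seq _ _ 1 1).
apply: (@runs_rarith _ _ (factors n)`_j j.+1%:R) => //=.
- lia.
(* The extra ['X] shifts indices: cell 2n + j + 1 holds coefficient j of the product. *)
- rewrite /cell/= e0 e2 fnd_set ifF; last lia.
  by rewrite -addnA addn1 h// coefXM.
- by rewrite /cell/= e0 fnd_set eqxx.
- by rewrite pnatr_eq0.
move=> b2.
apply: (@runs_seq _ _ 1 0).
apply: (@runs_rarith _ _ (\sum_(k < j) (factors n)`_k / k.+1%:R)
  ((factors n)`_j / j.+1%:R)) => //=.
- lia.
- by rewrite /cell/= !fnd_set/= ifF// e0; lia.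
- by rewrite /cell/= fnd_set.
move=> b3; apply: runs_iset => //=; split=> //= [|k kn|||]; rewrite ?fnd_set/=.
- by rewrite e0 e2 addn1.
- rewrite e0 !ifF ?h//; lia.
- by rewrite big_ord_recr.
- rewrite e0 !ifF//; lia.
- rewrite e0 ifF; last lia.
  by rewrite ifF ?eqxx//; lia.
Qed.

Lemma runs_compute st : bounded B st -> indices st 0%N = n ->
  holds (2 * n) (layout A U (fun => 0)) st ->
  runs B compute st (n * (1 + n * 3) + n * 3) (fun st' =>
    output st' = Some (\sum_(k < n) (factors n)`_k / k.+1%:R)).
Proof.
move=> b e0 h; apply: (@runs_seq _ _ 0 (n * (1 + n * 3) + n * 3)).
apply: (runs_weaken (runs_init b e0 h)) => // {b e0 h}st b h _.
apply: runs_seq.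
apply: (runs_weaken (runs_expand b h)) => // {b h}st b [e0 h] _.
exact: runs_integrate.
Qed.
End Correctness.

(** * From the input state to the complete run *)

Section Input.
Variables (R : realType) (n : nat) (r s : 'rV[R]_n) (i : 'I_n).

Definition on_nat (f : 'I_n -> R) (k : nat) : R := oapp f 0 (insub k).

Lemma on_natE f (j : 'I_n) : on_nat f j = f j.
Proof. by rewrite /on_nat valK. Qed.

Lemma fnd_input_state a :
  ((memory (input_state r s i)).[? a])%fmap =
  if (a < n + n)%N then Some (nth 0 (input_seq r s) a) else None.
Proof.
have domE : (a \in domf (memory (input_state r s i))) = (a < n + n)%N.
  by rewrite /= in_fset mem_iota.
rewrite -domE; case: fndP => // aI.
by rewrite ffunE.
Qed.

Lemma input_low (j : 'I_n) :
  ((memory (input_state r s i)).[? nat_of_ord j])%fmap = Some (r ord0 j).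
Proof.
rewrite fnd_input_state ifT; last by have := ltn_ord j; rewrite /=; lia.
rewrite /input_seq nth_cat size_map size_enum_ord ltn_ord.
by rewrite (nth_map j) ?size_enum_ord// nth_ord_enum.
Qed.

Lemma input_high (j : 'I_n) :
  ((memory (input_state r s i)).[? (n + j)%N])%fmap = Some (s ord0 j).
Proof.
rewrite fnd_input_state ifT; last by have := ltn_ord j; lia.
rewrite /input_seq nth_cat size_map size_enum_ord ltnNge leq_addr /= addKn.
by rewrite (nth_map j) ?size_enum_ord// nth_ord_enum.
Qed.

Lemma runs_ass_program :
  runs (3 * n + 3) ass_program (input_state r s i) (n * (1 + n * 3) + n * 3).+1
    (fun st => output st = Some (integral01 (path_poly r s i))).
Proof.
pose A := on_nat (lower r s i); pose U := on_nat (upper r s i).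
have n_gt0 : (0 < n)%N by have := ltn_ord i; lia.
have b : bounded (3 * n + 3) (input_state r s i).
  by move=> a; rewrite fnd_input_state; case: ltnP => // aN _; lia.
apply: (@runs_seq _ _ 1 (n * (1 + n * 3) + n * 3)).
apply: (@runs_seq _ _ 1 0).
apply: (@runs_rarith _ _ (s ord0 i) (r ord0 i)) => //=.
- by have := ltn_ord i; lia.
- exact: input_high.
- exact: input_low.
move=> b1; apply: (@runs_rcopy _ _ (s ord0 i - r ord0 i)) => //=.
- by have := ltn_ord i; lia.
- by rewrite /cell/= fnd_set eqxx.
move=> b2; rewrite (integral01_widen (size_path_poly r s i)).
have -> : path_poly r s i = factors A U n.
  by apply: eq_bigr => j _; rewrite /A /U !on_natE.
apply: runs_compute => // a an2; rewrite !fnd_set /=.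
(* Only cells i and n + i differ from the input; they match the case j = i of [lower] and
   [upper]. *)
have [an|an] := ltnP a n.
  rewrite ifF; last lia.
  rewrite layout1// -[a]/(val (Ordinal an)) /A on_natE /lower.
  by rewrite val_eqE; case: eqP => // _; exact: input_low.
have an' : (a - n < n)%N by lia.
rewrite -(subnKC an) layout2// -[(a - n)%N]/(val (Ordinal an')) /U on_natE /upper.
rewrite eqn_add2l val_eqE; case: eqP => // _.
rewrite ifF; last by have := ltn_ord i; rewrite /=; lia.
exact: input_high.
Qed.
End Input.

Theorem theorem4p5 (R : realType) :
  exists (p : cmd) (C : nat),
    forall (n : nat) (r s : 'rV[R]_n) (i : 'I_n),
      exists (z : R) (time space : nat) (st : state R),
        [/\ is_ass_attribution r s (fun x : 'rV[R]_n => \prod_(j < n) x ord0 j) i z,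
            exec p (input_state r s i) time space st,
            output st = Some z,
            (time <= C * n ^ 2)%N
          & (space <= C * n)%N].
Proof.
(* The time bound is 3n^2 + 4n + 1 and the space bound 3n + 3. As i exists, n >= 1, so these are at
   most 8n^2 and 6n. *)
exists ass_program, 8%N => n r s i.
have [t [m [st [ex tT mB _ out]]]] := runs_ass_program r s i.
exists (integral01 (path_poly r s i)), t, m, st; have n0 := ltn_ord i.
split=> //.
- split; [exact: multilinear_prod|exact: aumann_shapley_prod|exact: shapley_shubik_prod].
- by apply: leq_trans tT _; rewrite -mulnn; nia.
- by apply: leq_trans mB _; lia.
Qed.
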